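(* Let $X$ be an infinite compact metric space and $f:X\to X$ a continuous map. Then $(X,f)$ has both the gluing orbit property and zero topological entropy if and only if $(X,f)$ is minimal and equicontinuous; i.e. (equivalently to the latter) $(X,f)$ is topologically conjugate to a minimal rotation on a compact abelian group.
   Context: $\mathbb{Z}^+$ is the set of positive integers and $\mathbb{N}=\mathbb{Z}^+\cup\{0\}$. Let $(X,d)$ be a compact metric space and $f:X\to X$ continuous. Gluing orbit property: an orbit sequence is a sequence $\{(x_j,m_j)\}_{j\in\mathbb{Z}^+}$ in $X\times\mathbb{Z}^+$; a gap is a sequence $\{t_j\}_{j\in\mathbb{Z}^+}$ of positive integers. For $\varepsilon>0$, the pair (orbit sequence, gap) is $\varepsilon$-traced by $z\in X$ if for every $j\in\mathbb{Z}^+$, $d(f^{s_j+l}(z),f^l(x_j))\le\varepsilon$ for each $l=0,1,\dots,m_j-1$, where $s_1=0$ and $s_j=\sum_{i=1}^{j-1}(m_i+t_i-1)$ for $j\ge2$. $(X,f)$ has the gluing orbit property if for every $\varepsilon>0$ there is $M=M(\varepsilon)\in\mathbb{Z}^+$ such that for any orbit sequence there is a gap in $\{1,\dots,M\}^{\mathbb{Z}^+}$ such that the pair is $\varepsilon$-traced by some point of $X$. $(X,f)$ is minimal if every forward orbit $\{f^n(x):n\in\mathbb{N}\}$ is dense in $X$. $(X,f)$ is equicontinuous if for every $\varepsilon>0$ there is $\delta>0$ such that $d(x,y)<\delta$ implies $d(f^n(x),f^n(y))<\varepsilon$ for every $n\in\mathbb{N}$. A rotation on a compact abelian group $H$ is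 a map $h\mapsto h+a$ for a fixed $a\in H$. *)

(* Defs.v *)
From HB Require Import structures.
From mathcomp Require Import all_boot all_order all_algebra finmap.
From mathcomp Require Import all_classical all_reals all_analysis.

Set Implicit Arguments.
Unset Strict Implicit.
Unset Printing Implicit Defensive.

Import Order.TTheory GRing.Theory Num.Theory.
Import numFieldNormedType.Exports.

Local Open Scope classical_set_scope.
Local Open Scope ring_scope.

(* Sequences indexed by the positive integers are 0-based here: the term of
   index j >= 1 is the value at j - 1. *)

Definition orbit_sequence (X : Type) (C : nat -> X * nat) : Prop :=
  forall j, (0 < (C j).2)%N.

(* s_1 = 0 and s_j = \sum_(1 <= i < j) (m_i + t_i - 1); truncated subtraction
   is harmless since all m_i and t_i are positive. *)
Definition orbit_start (X : Type) (C : nat -> X * nat) (t : nat -> nat)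
    (j : nat) : nat :=
  (\sum_(i < j) ((C i).2 + t i - 1))%N.

Definition traced (R : realType) (X : metricType R) (f : X -> X) (eps : R)
    (C : nat -> X * nat) (t : nat -> nat) (z : X) : Prop :=
  forall j l : nat, (l < (C j).2)%N ->
    mdist (iter (orbit_start C t j + l) f z) (iter l f (C j).1) <= eps.

Definition gluing_orbit_property (R : realType) (X : metricType R)
    (f : X -> X) : Prop :=
  forall eps : R, 0 < eps ->
    exists2 M : nat, (0 < M)%N &
      forall C : nat -> X * nat, orbit_sequence C ->
        exists2 t : nat -> nat, (forall j, (1 <= t j <= M)%N) &
          exists z : X, traced f eps C t z.

(* Topological entropy is Bowen's: the limit, as eps tends to 0, of the
   exponential growth rate of the maximal cardinality of (n, eps)-separated
   sets. *)

Definition bowen_dist (R : realType) (X : metricType R) (f : X -> X)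
    (n : nat) (x y : X) : R :=
  \big[Num.max/0]_(l < n) mdist (iter l f x) (iter l f y).

Definition bowen_separated (R : realType) (X : metricType R) (f : X -> X)
    (n : nat) (eps : R) (E : {fset X}) : Prop :=
  forall x y : X, x \in E -> y \in E -> x != y -> eps < bowen_dist f n x y.

(* The supremum is a maximum when X is compact, f is continuous and eps > 0. *)
Definition max_separated (R : realType) (X : metricType R) (f : X -> X)
    (n : nat) (eps : R) : \bar R :=
  ereal_sup [set (#|` E|)%:R%:E | E in [set E | bowen_separated f n eps E]].

Definition entropy_at_scale (R : realType) (X : metricType R) (f : X -> X)
    (eps : R) : \bar R :=
  limn_esup (fun n => (n%:R^-1)%:E * lne (max_separated f n eps))%E.

(* entropy_at_scale is nonincreasing in eps, so the limit exists. *)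
Definition topological_entropy (R : realType) (X : metricType R)
    (f : X -> X) : \bar R :=
  lim (entropy_at_scale f eps @[eps --> 0^'+]).

Definition minimal_map (X : topologicalType) (f : X -> X) : Prop :=
  forall x : X, dense (range (fun n : nat => iter n f x)).

(* Uniform in the base point, unlike the pointwise notion equicontinuous of
   function_spaces, which also requires a pointed codomain. *)
Definition equicontinuous_map (R : realType) (X : metricType R)
    (f : X -> X) : Prop :=
  forall eps : R, 0 < eps -> exists2 delta : R, 0 < delta &
    forall x y : X, mdist x y < delta ->
      forall n : nat, mdist (iter n f x) (iter n f y) < eps.

Definition homeomorphism (X Y : topologicalType) (phi : X -> Y) : Prop :=
  continuous phi /\
  exists psi : Y -> X, [/\ continuous psi, cancel phi psi & cancel psi phi].

Definition topologically_conjugate (X Y : topologicalType)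
    (f : X -> X) (g : Y -> Y) : Prop :=
  exists2 phi : X -> Y, homeomorphism phi & forall x, phi (f x) = g (phi x).

Definition rotation (H : zmodType) (a h : H) : H := h + a.

(* Compact groups are Hausdorff by convention. *)
Definition conjugate_to_minimal_rotation (X : topologicalType)
    (f : X -> X) : Prop :=
  exists (H : topologicalZmodType) (a : H),
    [/\ hausdorff_space H, compact [set: H], minimal_map (rotation a)
      & topologically_conjugate f (rotation a)].

(* Main.v *)
Require Import Defs.
From HB Require Import structures.
From mathcomp Require Import all_boot all_order all_algebra finmap.
From mathcomp Require Import all_classical all_reals all_analysis.
From mathcomp Require Import lra zify.

(* Gluing and zero entropy: if some (N, 4 eps)-separated set E had at least
   2 (M(eps) + 1) points, gluing words of length n over E would give #|E|^n
   traced words for at most (M + 1)^n gap sequences, so 2^n of them share their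
   gaps and are shadowed by separated points; this is positive entropy. Hence
   separated sets have bounded size uniformly in N, so X is a finite union of
   closed sets that are small for the metric sup_n d(f^n x, f^n y), which forces
   equicontinuity. Gluing then moves any x close to any y, and equicontinuity
   replaces the tracing point by x itself, which is minimality.
   Conversely, a minimal equicontinuous f has uniformly bounded hitting times
   and uniformly bounded separated sets. The closeness of f^m and f^n is
   controlled by that of f^m x0 and f^n x0, so x + y := lim f^n y as f^n x0 -> x
   is a group law on X itself, for which f is the rotation by f x0. *)

Set Implicit Arguments.
Unset Strict Implicit.
Unset Printing Implicit Defensive.

Import Order.TTheory GRing.Theory Num.Theory.
Import numFieldNormedType.Exports.

Local Open Scope classical_set_scope.
Local Open Scope ring_scope.

(** * Metric and compactness preliminaries *)

Section metric_facts.
Context {R : realType} {X : metricType R}.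
Implicit Types (x y z : X) (e : R).

Lemma nbhs_mdistP x (P : X -> Prop) :
  (\forall y \near x, P y) <-> exists2 e, 0 < e & forall y, mdist x y < e -> P y.
Proof. by rewrite metricType_numDomainType.nbhs_mdistP. Qed.

Lemma near_mdist_lt x e : 0 < e -> \forall y \near x, mdist x y < e.
Proof. by move=> e0; apply/nbhs_mdistP; exists e. Qed.

Lemma mdist_le0_eq x y : (forall e, 0 < e -> mdist x y <= e) -> x = y.
Proof.
move=> xy; apply: mdist_positivity; apply/eqP; rewrite eq_le mdist_ge0 andbT.
by apply/ler_addgt0Pl => e /xy; rewrite addr0.
Qed.

Lemma dense_mdistP (S : set X) :
  dense S <-> forall y e, 0 < e -> exists2 x, S x & mdist x y < e.
Proof.
split=> [dS y e e0|dS O [y Oy] oO].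
- have ye : (ball y e)° !=set0 by exists y; exact: nbhsx_ballx.
  have [x [/interior_subset yx Sx]] := dS _ ye (@open_interior _ _).
  by exists x => //; rewrite metric_sym; rewrite ballEmdist in yx.
- have /nbhs_mdistP[e e0 yO] : nbhs y O by exact: open_nbhs_nbhs.
  have [x Sx xy] := dS y e e0.
  by exists x; split => //; apply: yO; rewrite metric_sym.
Qed.

Lemma minimal_mapP (f : X -> X) :
  minimal_map f <->
  forall x y e, 0 < e -> exists n, mdist (iter n f x) y < e.
Proof.
split=> [fmin x y e e0|fmin x].
- by have /dense_mdistP/(_ y e e0)[_ [n _ <-]] := fmin x; exists n.
- apply/dense_mdistP => y e /(fmin x y)[n xy].
  by exists (iter n f x) => //; exists n.
Qed.

Lemma iter_continuous (f : X -> X) n : continuous f -> continuous (iter n f).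
Proof.
move=> fcont; elim: n => [|n IHn] x; first exact: cvg_id.
exact: (continuous_comp (IHn x) (fcont _)).
Qed.

Hypothesis Xcpt : compact [set: X].

Lemma compact_mdist_net e : 0 < e ->
  exists s : seq X, forall x, exists2 p, p \in s & mdist x p < e.
Proof.
(* Along the filter of ever larger lists, the near-covering form of compactness yields one list that
   serves all points. *)
move=> e0; pose F : set_system (seq X) :=
  filter_from setT (fun s : seq X => [set s' : seq X | {subset s <= s'}]).
have FF : Filter F.
  apply: filter_from_filter; first by exists [::].
  move=> s s' _ _; exists (s ++ s') => // t sub.
  by split=> p ps; apply: sub; rewrite mem_cat ps ?orbT.
have /compact_near_coveringP cov := Xcpt.
have [x _|s _ /(_ s)] := cov _ F (fun s x => exists2 p, p \in s & mdist x p < e) FF.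
  exists ([set y | mdist x y < e], [set s | x \in s]) => /=.
    split; first exact: near_mdist_lt.
    by exists [:: x] => // s; apply; rewrite mem_head.
  by move=> [y s] /= [xy xs]; exists x => //; rewrite metric_sym.
by move=> sP; exists s => x; exact: sP.
Qed.

(** Heine-Cantor for a family, applied below to the iterates of [f] and to group translations
    carried over to [X]. *)
Lemma compact_equicontinuous (I : Type) (Y : metricType R) (F : I -> X -> Y) :
  (forall x e, 0 < e -> \forall y \near x, forall i, mdist (F i x) (F i y) < e) ->
  forall e, 0 < e -> exists2 delta, 0 < delta &
    forall x y, mdist x y < delta -> forall i, mdist (F i x) (F i y) < e.
Proof.
move=> Feq e e0; pose P (d : R) (x : X) :=
  forall y, mdist x y < d -> forall i, mdist (F i x) (F i y) < e.
have loc (x : X) : exists2 r, 0 < r &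
    forall x' d, mdist x x' < r -> d < r -> P d x'.
  have e2 : 0 < e / 2 by rewrite divr_gt0.
  have /nbhs_mdistP[r r0 xr] := Feq x _ e2.
  exists (r / 2); first by rewrite divr_gt0.
  move=> x' d xx' dr y x'y i.
  have h1 : mdist (F i x) (F i x') < e / 2 by apply: xr; lra.
  have h2 : mdist (F i x) (F i y) < e / 2.
    by apply: xr; have := metric_triangle x x' y; lra.
  have h3 := metric_triangle (F i x') (F i x) (F i y).
  by rewrite (metric_sym _ (F i x)) in h3; lra.
have /compact_near_coveringP cov := Xcpt.
have Pd : \forall d \near 0^'+, [set: X] `<=` P d.
  apply: cov => x _; have [r r0 xr] := loc x.
  near=> x' d; have dr : d < r by near: d; exact: nbhs_right_lt.
  have xx' : mdist x x' < r by near: x'; exact: near_mdist_lt.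
  exact: xr.
near (0 : R)^'+ => d; exists d; first by near: d; exact: nbhs_right_gt.
by move=> x; apply: (near Pd d).
Unshelve. all: by end_near. Qed.

End metric_facts.

Lemma le_limn_esup (R : realType) (u v : (\bar R)^nat) : (forall n, u n <= v n)%E ->
  (limn_esup u <= limn_esup v)%E.
Proof.
move=> uv; rewrite !limn_esup_lim; apply: lee_lim.
- exact: is_cvg_esups.
- exact: is_cvg_esups.
apply: nearW => n; apply: ge_ereal_sup => _ [m nm <-].
by apply: le_trans (uv m) _; apply: ereal_sup_ubound; exists m.
Qed.

(** * Topological entropy and separated sets *)

Section bowen.
Context {R : realType} {X : metricType R}.
Variable f : X -> X.
Implicit Types (x y z : X) (e : R).

Lemma bowen_dist_gtP n x y e : 0 <= e ->
  reflect (exists2 l, (l < n)%N & e < mdist (iter l f x) (iter l f y))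
    (e < bowen_dist f n x y).
Proof.
move=> e0; rewrite /bowen_dist; apply: (iffP idP) => [|[l ln el]].
- apply: contraPP => /forall2NP H; apply/negP; rewrite -leNgt.
  apply: bigmax_le => // -[l ln] _ /=.
  by have [//|/negP] := H l; rewrite -leNgt.
- by apply: (lt_le_trans el); apply: (le_bigmax _ _ (Ordinal ln)).
Qed.

Lemma bowen_separated_le n e e' (E : {fset X}) : e <= e' ->
  bowen_separated f n e' E -> bowen_separated f n e E.
Proof.
by move=> ee' sE x y xE yE xy; exact: (le_lt_trans ee' (sE _ _ xE yE xy)).
Qed.

Lemma max_separated_ge n e (E : {fset X}) : bowen_separated f n e E ->
  ((#|` E|)%:R%:E <= max_separated f n e)%E.
Proof. by move=> sE; apply: ereal_sup_ubound; exists E. Qed.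

Lemma max_separated_ge0 n e : (0 <= max_separated f n e)%E.
Proof.
rewrite (le_trans _ (@max_separated_ge n e fset0 _)) ?cardfs0//.
Qed.

Lemma entropy_at_scale_nonincreasing e e' : e <= e' ->
  (entropy_at_scale f e' <= entropy_at_scale f e)%E.
Proof.
move=> ee'; apply: le_limn_esup => n.
apply: lee_wpmul2l; first by rewrite lee_fin invr_ge0.
rewrite lee_lne ?in_itv/= ?leey ?andbT ?max_separated_ge0//.
apply: ge_ereal_sup => _ [E sE <-]; apply: max_separated_ge.
exact: bowen_separated_le sE.
Qed.

Lemma entropy_at_scale_le_entropy e : 0 < e ->
  (entropy_at_scale f e <= topological_entropy f)%E.
Proof.
move=> e0; rewrite /topological_entropy.
have /cvg_lim -> // : entropy_at_scale f e @[e --> 0^'+] -->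
    ereal_sup (entropy_at_scale f @` [set` Interval (BRight (0 : R)) +oo%O]).
  apply: nonincreasing_at_right_cvge => // x y _ _ xy.
  exact: entropy_at_scale_nonincreasing.
by apply: ereal_sup_ubound; exists e => //=; rewrite in_itv/= e0.
Qed.

(** Every tail of the upper limit contains a multiple of [T], and there the growth rate is at least
    [ln 2 / T]. *)
Lemma entropy_at_scale_ge e T : (0 < T)%N ->
  (forall n, exists2 E : {fset X},
    bowen_separated f (n * T) e E & (2 ^ n <= #|` E|)%N) ->
  ((ln 2 / T%:R)%:E <= entropy_at_scale f e)%E.
Proof.
move=> T0 sep; rewrite /entropy_at_scale limn_esup_lim.
apply: lime_ge; first exact: is_cvg_esups.
apply: nearW => m; set u := (X in esups X).
apply: (@le_trans _ _ (u (m.+1 * T)%N)); last first.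
  apply: ereal_sup_ubound; exists (m.+1 * T)%N => //=.
  by rewrite (leq_trans (leqnSn m))// leq_pmulr.
have [E sE cE] := sep m.+1; rewrite /u.
apply: (@le_trans _ _ (((m.+1 * T)%:R^-1)%:E * (ln (2 ^+ m.+1))%:E)%E).
  rewrite -EFinM lee_fin lnXn// -[ln 2 *+ _]mulr_natl natrM.
  by rewrite invfM mulrACA mulVf ?pnatr_eq0// mul1r mulrC.
apply: lee_wpmul2l; first by rewrite lee_fin invr_ge0.
rewrite -lne_EFin ?exprn_gt0// lee_lne ?in_itv/= ?leey ?andbT ?max_separated_ge0//.
  by apply: le_trans (max_separated_ge sE); rewrite lee_fin -natrX ler_nat.
Qed.

End bowen.

(** * Gluing, counting of words, and zero entropy *)

Lemma pigeonhole_fiber (A B : finType) (g : A -> B) (k : nat) :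
  (0 < #|B|)%N -> (#|B| * k <= #|A|)%N ->
  exists b, (k <= #|[set a | g a == b]%SET|)%N.
Proof.
move=> B0 BA; apply: contrapT => /forallNP fib.
have {}fib b : (#|[set a | g a == b]%SET| < k)%N.
  by have /negP := fib b; rewrite -ltnNge.
have cA : #|A| = (\sum_(b : B) #|[set a | g a == b]%SET|)%N.
  rewrite -sum1_card (partition_big g predT)//=.
  by apply: eq_bigr => b _; rewrite -sum1_card; apply: eq_bigl => a; rewrite inE.
have [b _] : exists b : B, b \in B by case/card_gt0P: B0 => b; exists b.
have k0 : (0 < k)%N := leq_ltn_trans (leq0n _) (fib b).
have : (#|A| <= #|B| * k.-1)%N.
  rewrite cA -sum_nat_const; apply: leq_sum => c _.
  by rewrite -ltnS prednK.
by move: BA B0 k0; case: k {fib} => // k; nia.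
Qed.

Section gluing.
Context {R : realType} {X : metricType R}.
Variable f : X -> X.
Implicit Types (x y z : X) (e : R).

(* Words over E are glued along blocks of the same length N.+1, so the starting
   times depend only on the gaps: among the points tracing words with equal
   gaps, different words give separated points. *)
Lemma gluing_separated e (M N n : nat) (E : {fset X}) : 0 < e -> (0 < M)%N ->
  (forall C : nat -> X * nat, orbit_sequence C ->
    exists2 t : nat -> nat, (forall j, (1 <= t j <= M)%N) &
      exists z : X, traced f e C t z) ->
  bowen_separated f N (4 * e) E -> (2 * M.+1 <= #|` E|)%N ->
  exists2 F : {fset X},
    bowen_separated f (n * (N.+1 + M)) e F & (2 ^ n <= #|` F|)%N.
Proof.
move=> e0 M0 glue sE cE.
have [a0 a0E] : exists a, a \in E by apply/fset0Pn; rewrite -cardfs_gt0; lia.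
pose W := {ffun 'I_n -> E}.
(* [a0] fills the positions past the word, and the block length [N.+1] is positive even for
   [N = 0]. *)
pose C (w : W) j : X * nat :=
  (if insub j is Some i then val (w i) else a0, N.+1).
have /choice[tz tzP] : forall w : W, exists tz : (nat -> nat) * X,
    (forall j, (1 <= tz.1 j <= M)%N) /\ traced f e (C w) tz.1 tz.2.
  by move=> w; have [//|t tM [z zP]] := glue (C w); exists (t, z).
pose g (w : W) : {ffun 'I_n -> 'I_M.+1} := [ffun i : 'I_n => inord ((tz w).1 i)].
(* There are at least [(2 * M.+1) ^ n] words and [M.+1 ^ n] possible values of [g], so some fibre
   has [2 ^ n] words. *)
have [||b bP] := @pigeonhole_fiber _ _ g (2 ^ n).
- by rewrite card_ffun !card_ord expn_gt0.
- rewrite !card_ffun !card_ord -cardfE -expnMn mulnC.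
  by have [n0|n0] := posnP n; [rewrite !n0|rewrite leq_exp2r].
pose s (w : W) := orbit_start (C w) (tz w).1.
have sM (w : W) (j : nat) : (s w j <= j * (N + M))%N.
  rewrite /s /orbit_start -[in leqRHS](card_ord j) -sum_nat_const.
  by apply: leq_sum => i _ /=; have := (tzP w).1 i; lia.
(* Only gaps before [j] enter the start of block [j]; [g] records them, and [inord] loses nothing as
   they are at most [M]. *)
have start_eq (w w' : W) (j : 'I_n) : g w = b -> g w' = b -> s w j = s w' j.
  move=> wb w'b; apply: eq_bigr => i _ /=.
  suff -> : (tz w).1 i = (tz w').1 i by [].
  have iN : (i < n)%N := ltn_trans (ltn_ord i) (ltn_ord j).
  have tM v : ((tz v).1 i < M.+1)%N by have /andP[] := (tzP v).1 i.
  have /(congr1 (fun h : {ffun 'I_n -> 'I_M.+1} => val (h (Ordinal iN)))) :=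
    etrans wb (esym w'b).
  by rewrite !ffunE /= !inordK.
have sep (w w' : W) : g w = b -> g w' = b -> w != w' ->
    e < bowen_dist f (n * (N.+1 + M)) (tz w).2 (tz w').2.
  move=> wb w'b ww'; have [j wj] : exists j, w j != w' j.
    by apply/existsP; rewrite -negb_forall; apply: contraNN ww' => /forallP h;
      apply/eqP/ffunP => i; apply/eqP.
  have e4 : 0 <= 4 * e by rewrite mulr_ge0// ltW.
  have /(bowen_dist_gtP _ _ _ _ e4)[l lN el] :=
    sE _ _ (valP (w j)) (valP (w' j)) wj.
  apply/bowen_dist_gtP; first exact: ltW.
  exists (s w j + l)%N.
    have := sM w j; have := ltn_ord j; nia.
  have Cj (v : W) : (C v j).1 = val (v j) by rewrite /C/= valK.
  (* The letters are more than [4 * e] apart at time [l] and each is traced within [e], which leaves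
     more than [2 * e] between the tracing points. *)
  have := (tzP w).2 j l (leqW lN); have := (tzP w').2 j l (leqW lN).
  rewrite -/(s w j) -/(s w' j) -(start_eq w w' j wb w'b) !Cj.
  set p' := iter l f _; set q' := iter _ f _; set p := iter l f _; set q := iter _ f _.
  move: el; rewrite -/p -/p' => el h' h.
  have := metric_triangle p' q' p; have := metric_triangle q' q p.
  rewrite (metric_sym p' q') (metric_sym p' p) (metric_sym q' q); lra.
have inj : {in [set w | g w == b]%SET &, injective (fun w => (tz w).2)}.
  move=> w w'; rewrite !inE => /eqP wb /eqP w'b zz'.
  apply/eqP; apply: contrapT => /negP /(sep _ _ wb w'b).
  rewrite zz' => /(bowen_dist_gtP _ _ _ _ (ltW e0))[l _].
  by rewrite mdistxx ltNge (ltW e0).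
exists [fset (tz w).2 | w in [set w | g w == b]%SET]%fset.
- move=> x y /imfsetP[w /= +] -> /imfsetP[w' /= +] ->.
  rewrite !inE => /eqP wb /eqP w'b zz'; apply: sep => //.
  by apply: contraNN zz' => /eqP ->.
- rewrite card_in_imfset//= (leq_trans bP)//.
  by rewrite cardE.
Qed.

(** The bound depends only on the maximal gap [M] at scale [e / 4]: reaching it for a single [N]
    would force entropy at least [ln 2 / (N.+1 + M)]. *)
Lemma gluing_zero_entropy_bounded e : gluing_orbit_property f ->
  topological_entropy f = 0%E -> 0 < e ->
  exists K, forall N (E : {fset X}), bowen_separated f N e E -> (#|` E| < K)%N.
Proof.
move=> glue h0 e0; have e4 : 0 < e / 4 by rewrite divr_gt0.
have [M M0 MP] := glue _ e4; exists (2 * M.+1)%N => N E.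
rewrite (_ : e = 4 * (e / 4)); last by rewrite mulrC divfK.
move=> sE; rewrite ltnNge; apply/negP => cE.
have /(@entropy_at_scale_ge R X) : forall n, exists2 F : {fset X},
    bowen_separated f (n * (N.+1 + M)) (e / 4) F & (2 ^ n <= #|` F|)%N.
  by move=> n; exact: (gluing_separated n e4 M0 MP sE cE).
move=> /(_ isT)/le_trans/(_ (entropy_at_scale_le_entropy f e4)).
rewrite h0 lee_fin leNgt => /negP; apply.
by rewrite divr_gt0// ?ltr0n// ln_gt0// ltr1n.
Qed.

End gluing.

(** * Equicontinuity, minimality and their consequences *)

Lemma near_seq_forall (T : Type) (I : eqType) (F : set_system T)
    (FF : Filter F) (s : seq I) (P : I -> T -> Prop) :
  (forall i, \forall t \near F, P i t) ->
  \forall t \near F, forall i, i \in s -> P i t.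
Proof.
move=> FP; elim: s => [|i s IHs]; first by apply: nearW.
near=> t => j; rewrite inE => /predU1P[->|]; first by near: t.
by move: j; near: t.
Unshelve. all: by end_near. Qed.

Section equicontinuous_dynamics.
Context {R : realType} {X : metricType R}.
Variable f : X -> X.
Implicit Types (x y z : X) (e : R).

(** Without such a net, points could be added greedily until [K] of them have orbits that pairwise
    separate at some time. Finitely many pairs separate within a common window, against the
    bound. *)
Lemma bounded_separated_net e (K : nat) : 0 < e ->
  (forall N (E : {fset X}), bowen_separated f N e E -> (#|` E| < K)%N) ->
  exists E : {fset X}, forall y, exists2 x, x \in E &
    forall n, mdist (iter n f x) (iter n f y) <= e.
Proof.
move=> e0 bnd; apply: contrapT => /forallNP noE.
have [E sE cE] : exists2 E : {fset X}, (forall x y, x \in E -> y \in E ->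
    x != y -> exists n, e < mdist (iter n f x) (iter n f y)) & #|` E| = K.
  elim: K {bnd} => [|k [E sE cE]].
    by exists fset0; rewrite ?cardfs0// => x y; rewrite inE.
  have /existsNP[y /forall2NP yE] := noE E.
  have {}yE x : x \in E -> exists n, e < mdist (iter n f x) (iter n f y).
    move=> xE; have [//|/existsNP[n /negP]] := yE x.
    by rewrite -ltNge; exists n.
  have yNE : y \notin E.
    by apply/negP => /yE[n]; rewrite mdistxx ltNge (ltW e0).
  exists (y |` E)%fset; last by rewrite cardfsU1 yNE cE.
  move=> u v /fset1UP[->|uE] /fset1UP[->|vE] uv.
  - by rewrite eqxx in uv.
  - by have [n] := yE _ vE; exists n; rewrite metric_sym.
  - exact: yE.
  - exact: sE.
have /choice[N NP] : forall p : X * X, exists n, p.1 \in E -> p.2 \in E ->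
    p.1 != p.2 -> e < mdist (iter n f p.1) (iter n f p.2).
  move=> [x y] /=; have [[xE [yE xy]]|nxy] := pselect (x \in E /\ y \in E /\ x != y).
    by have [n ?] := sE x y xE yE xy; exists n.
  by exists 0%N => xE yE xy; case: nxy.
have := bnd (\max_(x <- E) \max_(y <- E) (N (x, y)).+1)%N E.
rewrite cE ltnn => H; apply: notF; apply: H => x y xE yE xy.
apply/bowen_dist_gtP; first exact: ltW.
exists (N (x, y)); last exact: (NP (x, y)).
rewrite (leq_trans (leq_bigmax_seq (F := fun y => (N (x, y)).+1) y yE isT))//.
exact: (leq_bigmax_seq (F := fun x => \max_(y <- E) (N (x, y)).+1)%N x xE isT).
Qed.

Hypotheses (Xcpt : compact [set: X]) (fcont : continuous f).

(** The net covers [X] by finitely many closed sets of points with close orbits. A small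
    neighbourhood of [x] meets only those that contain [x], so each [y] in it shares one with
    [x]. *)
Lemma bounded_separated_equicontinuous :
  (forall e, 0 < e -> exists K, forall N (E : {fset X}),
    bowen_separated f N e E -> (#|` E| < K)%N) ->
  equicontinuous_map f.
Proof.
move=> bnd e e0.
have [|d d0 dP] := @compact_equicontinuous _ _ Xcpt nat X (fun n => iter n f) _ e e0;
  last by exists d.
move=> x {}e {}e0; have e3 : 0 < e / 3 by rewrite divr_gt0.
have [K /(bounded_separated_net e3)[E EP]] := bnd _ e3.
pose near_orbit p y := forall n, mdist (iter n f p) (iter n f y) <= e / 3.
have cl p : \forall y \near x, near_orbit p y -> near_orbit p x.
  have [px|/existsNP[n /negP]] := pselect (near_orbit p x); first by apply: nearW.
  rewrite -ltNge -subr_gt0 => pn.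
  have /metricType_numDomainType.cvgrPdist_lt := @iter_continuous _ _ f n fcont x.
  move=> /(_ _ pn); apply: filterS => y xy py; exfalso.
  have := py n; have := metric_triangle (iter n f p) (iter n f y) (iter n f x).
  rewrite (metric_sym (iter n f y)); lra.
apply: filterS (near_seq_forall (nbhs_filter x) E cl) => y Ey n.
have [p pE py] := EP y; have /(_ n) px := Ey p pE py.
have {}py := py n; have := metric_triangle (iter n f x) (iter n f p) (iter n f y).
rewrite (metric_sym (iter n f x) (iter n f p)); lra.
Qed.

(** The tracing point [z] starts near [x] and later comes near [y]; by equicontinuity [x] follows
    [z]. *)
Lemma gluing_equicontinuous_minimal :
  gluing_orbit_property f -> equicontinuous_map f -> minimal_map f.
Proof.
move=> glue eqf; apply/minimal_mapP => x y e e0.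
have e2 : 0 < e / 2 by rewrite divr_gt0.
have [d d0 dP] := eqf _ e2.
have r0 : 0 < Num.min (d / 2) (e / 2) by rewrite lt_min !divr_gt0.
(* With blocks of length 1 the second one starts at [1 + t 0 - 1], which is the first gap. *)
have [M _ /(_ (fun j => (if j is 0%N then x else y, 1%N)))[//|t tM [z zP]]] :=
  glue _ r0.
have := zP 0%N 0%N isT; have := zP 1%N 0%N isT.
rewrite /orbit_start big_ord1 big_ord0 /= !addn0 addKn !le_min.
set n := t _ => /andP[_ ny] /andP[zx _].
exists n.
have /dP/(_ n) zxn : mdist z x < d by lra.
have := metric_triangle (iter n f x) (iter n f z) y.
rewrite (metric_sym (iter n f x) (iter n f z)); lra.
Qed.

Hypotheses (fmin : minimal_map f) (eqf : equicontinuous_map f).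

(** Minimality gives hitting times between the points of a finite net, hence a bound for these;
    equicontinuity passes it on to nearby points. *)
Lemma minimal_equicontinuous_hitting e : 0 < e ->
  exists2 M, (0 < M)%N & forall x y,
    exists2 t, (1 <= t <= M)%N & mdist (iter t f x) y < e.
Proof.
move=> e0; have e3 : 0 < e / 3 by rewrite divr_gt0.
have [d d0 dP] := eqf e3.
have r0 : 0 < Num.min d (e / 3) by rewrite lt_min d0.
have [s sP] := compact_mdist_net Xcpt r0.
(* Starting from [f p.1] makes the hitting time a successor, hence positive as a gap must be. *)
have /choice[N NP] : forall p : X * X,
    exists n, mdist (iter n f (f p.1)) p.2 < e / 3.
  by move=> p; have /minimal_mapP := fmin; apply.
exists (\max_(x <- s) \max_(y <- s) (N (x, y)).+1).+1%N => // x y.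
have [p ps] := sP x; rewrite lt_min => /andP[xp _].
have [q qs] := sP y; rewrite lt_min => /andP[_ yq].
exists (N (p, q)).+1.
  rewrite ltn0Sn/= leqW//.
  rewrite (leq_trans (leq_bigmax_seq (F := fun y => (N (p, y)).+1) q qs isT))//.
  exact: (leq_bigmax_seq (F := fun x => \max_(y <- s) (N (x, y)).+1)%N p ps isT).
have := NP (p, q); rewrite /= -iterSr => pq.
have xpN := dP _ _ xp (N (p, q)).+1.
have := metric_triangle (iter (N (p, q)).+1 f x) (iter (N (p, q)).+1 f p) y.
have := metric_triangle (iter (N (p, q)).+1 f p) q y.
rewrite (metric_sym q); lra.
Qed.

(** The first point of the sequence traces all of it: each gap is a hitting time that brings its
    orbit [d]-close to the next point, and equicontinuity does the rest of the block. *)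
Lemma minimal_equicontinuous_gluing : gluing_orbit_property f.
Proof.
move=> e e0; have [d d0 dP] := eqf e0.
have [M M0 MP] := minimal_equicontinuous_hitting d0; exists M => // C C0.
have /choice[h hP] : forall p : X * X, exists t,
    (1 <= t <= M)%N /\ mdist (iter t f p.1) p.2 < d.
  by move=> p; have [t tM pt] := MP p.1 p.2; exists t.
pose z := (C 0%N).1.
(* The gap is counted from the last time of block [j], which matches the [- 1] in [orbit_start]. *)
pose gap j s := h (iter (s + (C j).2).-1 f z, (C j.+1).1).
pose start := fix start j := if j is i.+1 then
  ((start i + (C i).2).-1 + gap i (start i))%N else 0%N.
pose t j := gap j (start j).
have tM j : (1 <= t j <= M)%N.
  by have [] := hP (iter (start j + (C j).2).-1 f z, (C j.+1).1).
have startE j : orbit_start C t j = start j.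
  elim: j => [|j IHj]; first by rewrite /orbit_start big_ord0.
  rewrite /orbit_start big_ord_recr /= -/(orbit_start C t j) IHj -/(t j).
  by have := C0 j; have := tM j; lia.
exists t => //; exists z => j l _.
rewrite startE addnC iterD; apply/ltW/dP.
case: j => [|j]; first by rewrite mdistxx.
rewrite [start _]/= addnC iterD.
by have [] := hP (iter (start j + (C j).2).-1 f z, (C j.+1).1).
Qed.

(** Orbits of points near the same net point never separate, so a separated set injects into the
    net. *)
Lemma equicontinuous_separated_bounded e : 0 < e ->
  exists2 K, (0 < K)%N & forall N (E : {fset X}),
    bowen_separated f N e E -> (#|` E| <= K)%N.
Proof.
move=> e0; have [d d0 dP] := eqf e0.
have d2 : 0 < d / 2 by rewrite divr_gt0.
have [s sP] := compact_mdist_net Xcpt d2.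
have /choice[c cP] : forall x, exists p, p \in s /\ mdist x p < d / 2.
  by move=> x; have [p ps xp] := sP x; exists p.
(* The successor keeps the bound positive, since its logarithm is taken later. *)
exists (size s).+1 => // N E sE.
have cinj : {in E &, injective c}.
  move=> x y xE yE cxy; apply/eqP; apply: contrapT => /negP xy.
  have /(bowen_dist_gtP _ _ _ _ (ltW e0))[l _] := sE x y xE yE xy.
  rewrite ltNge => /negP; apply; apply/ltW/dP.
  have := metric_triangle x (c x) y; have := (cP x).2; have := (cP y).2.
  rewrite cxy (metric_sym (c y)); lra.
rewrite -(size_map c (enum_fset E)) leqW// uniq_leq_size//.
  by rewrite map_inj_in_uniq// fset_uniq.
by move=> _ /mapP[x _ ->]; exact: (cP x).1.
Qed.

(** The maximal cardinality stays between [1] and a constant, so its logarithm divided by [n] tends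
    to [0]. *)
Lemma equicontinuous_entropy_at_scale e : 0 < e -> X ->
  entropy_at_scale f e = 0%E.
Proof.
move=> e0 x0; have [K K0 KP] := equicontinuous_separated_bounded e0.
have sep_ge1 n : (1 <= max_separated f n e)%E.
  rewrite (le_trans _ (@max_separated_ge _ _ f n e [fset x0]%fset _)) ?cardfs1//.
  by move=> x y /fset1P-> /fset1P->; rewrite eqxx.
have sep_leK n : (max_separated f n e <= K%:R%:E)%E.
  by apply: ge_ereal_sup => _ [E sE <-]; rewrite lee_fin ler_nat; exact: (KP n).
rewrite /entropy_at_scale; set u := (X in limn_esup X).
suff /cvg_limn_einf_sup[] : u @ \oo --> 0%E by [].
apply: (@squeeze_cvge _ _ _ _ (cst 0%E) _ (fun n => (n%:R^-1 * ln K%:R)%:E)).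
- apply: nearW => n; rewrite mule_ge0 ?lee_fin ?invr_ge0// ?lne_ge0//=.
  rewrite EFinM lee_wpmul2l ?lee_fin ?invr_ge0//.
  by rewrite -lne_EFin ?ltr0n// lee_lne ?in_itv/= ?leey ?andbT ?max_separated_ge0.
- exact: cvg_cst.
- apply: cvg_EFin; first by apply: nearW.
  rewrite -(mul0r (ln K%:R)); apply: cvgMl.
  by rewrite -cvg_shiftS; exact: cvg_harmonic.
Qed.

Lemma equicontinuous_zero_entropy : X -> topological_entropy f = 0%E.
Proof.
move=> x0; apply/cvg_lim => //; apply: cvg_near_cst.
by near=> e; exact: equicontinuous_entropy_at_scale.
Unshelve. all: by end_near. Qed.

End equicontinuous_dynamics.

(** * The group law on [X] *)

Section orbit_group.
Context {R : realType} {X : metricType R}.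
Variable f : X -> X.
Hypotheses (Xcpt : compact [set: X]) (fmin : minimal_map f)
  (eqf : equicontinuous_map f).
Variable x0 : X.
Implicit Types (x y z : X) (e : R).

Lemma orbit_approx x e : 0 < e -> exists n, mdist (iter n f x0) x < e.
Proof. by move: x0 x e; exact/minimal_mapP. Qed.

(** Iterates commute, so closeness at [x0] passes to the whole orbit of [x0], and by density to
    every [y]. *)
Lemma orbit_return_uniform e : 0 < e -> exists2 d, 0 < d &
  forall m n, mdist (iter m f x0) (iter n f x0) < d ->
    forall y, mdist (iter m f y) (iter n f y) <= e.
Proof.
move=> e0; have e3 : 0 < e / 3 by rewrite divr_gt0.
have [d d0 dP] := eqf e3; exists d => // m n mn y.
have [k ky] := orbit_approx y d0.
have h1 := dP _ _ ky m; have h2 := dP _ _ ky n; have h3 := dP _ _ mn k.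
move: h3; rewrite -!iterD !(addnC k) !iterD => h3.
have t1 := metric_triangle (iter m f y) (iter m f (iter k f x0)) (iter n f y).
have := metric_triangle (iter m f (iter k f x0)) (iter n f (iter k f x0)) (iter n f y).
by rewrite (metric_sym (iter m f y) (iter m f (iter k f x0))) in t1; lra.
Qed.

(** The times at which [x0] comes near [x] generate a proper filter. Compactness gives a cluster
    point of [iter n f y] along it, which [orbit_return_uniform] turns into a limit. *)
Lemma orbit_add_exists x y : exists z, forall e, 0 < e -> exists2 d, 0 < d &
  forall n, mdist (iter n f x0) x < d -> mdist (iter n f y) z <= e.
Proof.
pose near_x r := [set n | mdist (iter n f x0) x < r].
pose F := filter_from [set r : R | 0 < r] near_x.
have FF : ProperFilter F.
  apply: filter_from_proper; last by move=> r /orbit_approx; exact.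
  apply: filter_from_filter; first by exists 1; exact: ltr01.
  move=> r s r0 s0; exists (Num.min r s); first by rewrite /= lt_min r0.
  by move=> n; rewrite /near_x /= lt_min => /andP[].
have [|z [_ zcl]] := Xcpt (fmap_proper_filter (fun n => iter n f y) FF).
  exact: filterT.
exists z => e e0; have e2 : 0 < e / 2 by rewrite divr_gt0.
have [d d0 dP] := orbit_return_uniform e2.
exists (d / 2); first by rewrite divr_gt0.
move=> n nx; pose A := [set iter m f y | m in near_x (d / 2)].
have FA : ((fun n => iter n f y) @ F) A.
  by exists (d / 2); [rewrite /= divr_gt0|move=> m mx; exists m].
have [_ [[m mx <-] zm]] := zcl _ _ FA (near_mdist_lt z e2).
have mn : mdist (iter m f x0) (iter n f x0) < d.
  have := metric_triangle (iter m f x0) x (iter n f x0); move: mx.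
  by rewrite /near_x /= (metric_sym x); lra.
have := dP _ _ mn y; move: zm => /=.
have := metric_triangle (iter n f y) (iter m f y) z.
rewrite (metric_sym (iter n f y) (iter m f y)) (metric_sym z); lra.
Qed.

(* The limit of [iter n f y] as [iter n f x0] tends to [x]. *)
Definition orbit_add x y : X := sval (cid (orbit_add_exists x y)).

Lemma orbit_add_lim e : 0 < e -> exists2 d, 0 < d & forall x y n,
  mdist (iter n f x0) x < d -> mdist (iter n f y) (orbit_add x y) <= e.
Proof.
move=> e0; have e2 : 0 < e / 2 by rewrite divr_gt0.
have [d d0 dP] := orbit_return_uniform e2.
exists (d / 2); first by rewrite divr_gt0.
move=> x y n nx; have [d' d'0 d'P] := svalP (cid (orbit_add_exists x y)) _ e2.
have r0 : 0 < Num.min (d / 2) d' by rewrite lt_min d'0 divr_gt0.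
have [m] := orbit_approx x r0; rewrite lt_min => /andP[mx /d'P my].
have mn : mdist (iter n f x0) (iter m f x0) < d.
  have := metric_triangle (iter n f x0) x (iter m f x0).
  by rewrite (metric_sym x); lra.
have := dP _ _ mn y; have := metric_triangle (iter n f y) (iter m f y) (orbit_add x y).
by move: my; rewrite -/(orbit_add x y); lra.
Qed.

(** On the orbit of [x0] the law is thus addition of exponents; commutativity and associativity
    follow by density. *)
Lemma orbit_add_iter n y : orbit_add (iter n f x0) y = iter n f y.
Proof.
apply/esym/mdist_le0_eq => e /orbit_add_lim[d d0]; apply.
by rewrite mdistxx.
Qed.

(** One iterate of [x0] near both [x] and [x'] computes both sums approximately, and equicontinuity
    moves [y] to [y']. *)
Lemma orbit_add_unif e : 0 < e -> exists2 d, 0 < d & forall x x' y y',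
  mdist x x' < d -> mdist y y' < d ->
  mdist (orbit_add x y) (orbit_add x' y') <= e.
Proof.
move=> e0; have e3 : 0 < e / 3 by rewrite divr_gt0.
have [d d0 dP] := orbit_add_lim e3; have [d' d'0 d'P] := eqf e3.
exists (Num.min (d / 2) d'); first by rewrite lt_min d'0 divr_gt0.
move=> x x' y y'; rewrite !lt_min => /andP[xx' _] /andP[_ yy'].
have d2 : 0 < d / 2 by rewrite divr_gt0.
have [n nx] := orbit_approx x d2.
have nx' : mdist (iter n f x0) x' < d.
  by have := metric_triangle (iter n f x0) x x'; lra.
have h1 : mdist (iter n f y) (orbit_add x y) <= e / 3 by apply: dP; lra.
have h2 := dP x' y' n nx'; have h3 := d'P _ _ yy' n.
have := metric_triangle (orbit_add x y) (iter n f y) (orbit_add x' y').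
have := metric_triangle (iter n f y) (iter n f y') (orbit_add x' y').
rewrite (metric_sym (orbit_add x y) (iter n f y)); lra.
Qed.

Lemma orbit_add_continuous : continuous (fun p : X * X => orbit_add p.1 p.2).
Proof.
move=> [x y]; apply/metricType_numDomainType.cvgrPdist_lt => e e0.
have e2 : 0 < e / 2 by rewrite divr_gt0.
have [d d0 dP] := orbit_add_unif e2.
exists ([set x' | mdist x x' < d], [set y' | mdist y y' < d]).
  by split; exact: near_mdist_lt.
move=> [x' y'] /= [xx' yy'].
by rewrite (le_lt_trans (dP _ _ _ _ xx' yy'))// ltr_pdivrMr// ltr_pMr// ltr1n.
Qed.

Lemma orbit_addl_continuous y : continuous (orbit_add^~ y).
Proof.
move=> x; apply: (@continuous2_cvg _ _ _ _ _ _ id (cst y) orbit_add).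
- exact: (@orbit_add_continuous (x, y)).
- exact: cvg_id.
- exact: cvg_cst.
Qed.

Lemma orbit_addr_continuous x : continuous (orbit_add x).
Proof.
move=> y; apply: (@continuous2_cvg _ _ _ _ _ _ (cst x) id orbit_add).
- exact: (@orbit_add_continuous (x, y)).
- exact: cvg_cst.
- exact: cvg_id.
Qed.

Lemma orbit_continuous_eq (g h : X -> X) : continuous g -> continuous h ->
  (forall n, g (iter n f x0) = h (iter n f x0)) -> g =1 h.
Proof.
move=> gc hc gh x; apply: mdist_le0_eq => e e0.
have e2 : 0 < e / 2 by rewrite divr_gt0.
have /metricType_numDomainType.cvgrPdist_lt/(_ _ e2)/nbhs_mdistP[d d0 gd] := gc x.
have /metricType_numDomainType.cvgrPdist_lt/(_ _ e2)/nbhs_mdistP[d' d'0 hd] := hc x.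
have r0 : 0 < Num.min d d' by rewrite lt_min d0.
have [n] := orbit_approx x r0.
rewrite metric_sym lt_min => /andP[/gd gn /hd hn].
have := metric_triangle (g x) (g (iter n f x0)) (h x).
rewrite gh in gn *; rewrite (metric_sym (h (iter n f x0))); lra.
Qed.

Lemma orbit_addC : commutative orbit_add.
Proof.
move=> x y; move: x; apply: orbit_continuous_eq.
- exact: orbit_addl_continuous.
- exact: orbit_addr_continuous.
move=> n; move: y; apply: orbit_continuous_eq.
- exact: orbit_addr_continuous.
- exact: orbit_addl_continuous.
by move=> m; rewrite !orbit_add_iter -!iterD addnC.
Qed.

Lemma orbit_addA : associative orbit_add.
Proof.
move=> x y z; move: x; apply: orbit_continuous_eq.
- exact: orbit_addl_continuous.
- move=> x; apply: (@continuous_comp _ _ _ (orbit_add^~ y) (orbit_add^~ z)).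
  + exact: orbit_addl_continuous.
  + exact: orbit_addl_continuous.
move=> n; rewrite !orbit_add_iter; move: y; apply: orbit_continuous_eq.
- move=> y; apply: (@continuous_comp _ _ _ (orbit_add^~ z) (iter n f)).
  + exact: orbit_addl_continuous.
  (* [iter n f] is the translation by [iter n f x0], so it is continuous because the addition is. *)
  + by rewrite -(funext (orbit_add_iter n)); exact: orbit_addr_continuous.
- move=> y; apply: (@continuous_comp _ _ _ (iter n f) (orbit_add^~ z)).
  + by rewrite -(funext (orbit_add_iter n)); exact: orbit_addr_continuous.
  + exact: orbit_addl_continuous.
by move=> m; rewrite -iterD !orbit_add_iter iterD.
Qed.

Lemma orbit_add0 : left_id x0 orbit_add.
Proof. by move=> y; rewrite (orbit_add_iter 0). Qed.

(** The translates of [x] form a compact, hence closed, set that contains the dense orbit of [x]. *)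
Lemma orbit_opp_exists x : exists y, orbit_add y x = x0.
Proof.
have cl : closed (range (orbit_add^~ x)).
  apply: compact_closed; first exact: metric_hausdorff.
  apply: continuous_compact => //.
  by apply: continuous_subspaceT; exact: orbit_addl_continuous.
suff [y _ yx] : range (orbit_add^~ x) x0 by exists y.
apply: cl => B /nbhs_mdistP[r r0 rB].
have /minimal_mapP/(_ x x0 r r0)[n nx] := fmin.
exists (iter n f x); split; last by apply: rB; rewrite metric_sym.
by exists (iter n f x0) => //; rewrite orbit_add_iter.
Qed.

Definition orbit_opp x : X := sval (cid (orbit_opp_exists x)).

Lemma orbit_addN : left_inverse x0 orbit_opp orbit_add.
Proof. by move=> x; rewrite /orbit_opp; case: cid. Qed.

(* Translating x and y by -(x + y) gives -y and -x, so opposites are as close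
   as the uniform continuity of the addition tells. *)
Lemma orbit_opp_continuous : continuous orbit_opp.
Proof.
move=> x; apply/metricType_numDomainType.cvgrPdist_lt => e e0.
have e2 : 0 < e / 2 by rewrite divr_gt0.
have [d d0 dP] := orbit_add_unif e2; apply/nbhs_mdistP; exists d => // y xy.
have oppE u v : orbit_add (orbit_add (orbit_opp u) (orbit_opp v)) u = orbit_opp v.
  by rewrite orbit_addC orbit_addA (orbit_addC u) orbit_addN orbit_add0.
pose w := orbit_add (orbit_opp x) (orbit_opp y).
have wx : orbit_add w x = orbit_opp y by exact: oppE.
have wy : orbit_add w y = orbit_opp x by rewrite /w (orbit_addC (orbit_opp x)) oppE.
have ww : mdist w w < d by rewrite mdistxx.
have := dP w w x y ww xy; rewrite wx wy (metric_sym (orbit_opp y)); lra.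
Qed.

Lemma orbit_addr_generator x : orbit_add x (f x0) = f x.
Proof. by rewrite orbit_addC (orbit_add_iter 1). Qed.

Lemma orbit_group_conjugate : conjugate_to_minimal_rotation f.
Proof.
pose zmod := GRing.isZmodule.Build X orbit_addA orbit_addC orbit_add0 orbit_addN.
(* [H0] joins the group law to the given topology of [X], so the conjugacy can be the identity. *)
pose H0 : PreTopologicalZmodule.type := HB.pack X zmod.
pose addc := PreTopologicalNmodule_isTopologicalNmodule.Build H0 orbit_add_continuous.
pose oppc := TopologicalNmodule_isTopologicalZmodule.Build H0 orbit_opp_continuous.
pose H : topologicalZmodType := HB.pack X zmod addc oppc.
have fE : rotation (f x0 : H) = f by apply/funext => x; exact: orbit_addr_generator.
exists H, (f x0); split.
- exact: (@metric_hausdorff R X).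
- exact: Xcpt.
- by rewrite fE.
- exists id; last by move=> x; rewrite fE.
  split; first by move=> x; exact: cvg_id.
  by exists id; split => // x; exact: cvg_id.
Qed.

End orbit_group.

(** * Maps conjugate to minimal rotations *)

Section conjugate.
Context {R : realType} {X : metricType R}.
Variable f : X -> X.

Lemma rotation_iter (H : zmodType) (a h : H) n : iter n (rotation a) h = h + a *+ n.
Proof. by elim: n => [|n IHn]; rewrite ?addr0//= IHn /rotation mulrSr addrA. Qed.

(** Each [iter n f] is conjugate to the translation by [a *+ n], and the family of all translations,
    indexed by the compact group [H], is equicontinuous. *)
Lemma conjugate_rotation_minimal_equicontinuous : compact [set: X] ->
  conjugate_to_minimal_rotation f -> minimal_map f /\ equicontinuous_map f.
Proof.
move=> Xcpt [H [a [Hhaus Hcpt amin [phi [phic [psi [psic phiK psiK]]] phif]]]].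
have iterE n x : phi (iter n f x) = iter n (rotation a) (phi x).
  by elim: n => //= n IHn; rewrite phif IHn.
split.
- move=> x O [y Oy] oO.
  have [||h [Oh [n _ hE]]] := amin (phi x) (psi @^-1` O).
  + by exists (phi y); rewrite /= phiK.
  + exact: open_comp.
  + exists (psi h); split => //; exists n => //.
    by apply: (can_inj phiK); rewrite psiK iterE.
- pose g h x := psi (phi x + h).
  have gc : continuous (fun p : H * X => g p.1 p.2).
    move=> p; apply: (@continuous_comp _ _ _ (fun p : H * X => phi p.2 + p.1) psi);
      last exact: psic.
    apply: (@continuous2_cvg _ _ _ _ _ _ (phi \o snd) fst (fun u v : H => u + v)).
    + exact: (@add_continuous H (phi p.2, p.1)).
    + by apply: continuous_comp; [exact: cvg_snd|exact: phic].
    + exact: cvg_fst.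
  move=> e e0.
  have [|d d0 dP] := @compact_equicontinuous _ _ Xcpt H X g _ e e0; last first.
    exists d => // x y xy n.
    have fE z : iter n f z = g (a *+ n) z.
      by apply: (can_inj phiK); rewrite iterE rotation_iter psiK.
    by rewrite !fE; exact: dP.
  move=> x {}e {}e0; have /compact_near_coveringP cov := Hcpt.
  have e2 : 0 < e / 2 by rewrite divr_gt0.
  (* Joint continuity of [g] handles the parameters near each [h]; compactness of [H] gives one
     neighbourhood of [x] for all. *)
  have near_g : \forall y \near x, [set: H] `<=` [set h | mdist (g h x) (g h y) < e].
    apply: (cov X (nbhs x) (fun y h => mdist (g h x) (g h y) < e)) => h _.
    have /metricType_numDomainType.cvgrPdist_lt/(_ _ e2) := gc (h, x).
    move=> [[U V] /= [Uh Vx] UV]; exists (U, V) => // -[h' y] /= [Uh' Vy].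
    have := UV (h', x) (conj Uh' (nbhs_singleton Vx)).
    have := UV (h', y) (conj Uh' Vy); rewrite /=.
    have := metric_triangle (g h' x) (g h x) (g h' y).
    rewrite (metric_sym (g h' x) (g h x)); lra.
  by apply: filterS near_g => y gy h; exact: gy.
Qed.

End conjugate.

Theorem theorem1p1 (R : realType) (X : metricType R) (f : X -> X)
    (Xinf : infinite_set [set: X]) (Xcpt : compact [set: X])
    (fcont : continuous f) :
  ((gluing_orbit_property f /\ topological_entropy f = 0%E) <->
     (minimal_map f /\ equicontinuous_map f)) /\
  ((minimal_map f /\ equicontinuous_map f) <->
     conjugate_to_minimal_rotation f).
Proof.
have [x0 _] : [set: X] !=set0 by exact: infinite_setN0.
split; split.
- move=> [glue h0].
  have eqf : equicontinuous_map f.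
    apply: bounded_separated_equicontinuous => // e.
    exact: gluing_zero_entropy_bounded.
  by split; [exact: gluing_equicontinuous_minimal|].
- move=> [fmin eqf]; split; first exact: minimal_equicontinuous_gluing.
  exact: equicontinuous_zero_entropy.
- by move=> [fmin eqf]; exact: orbit_group_conjugate.
- exact: conjugate_rotation_minimal_equicontinuous.
Qed.
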